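(* $$\int_0^\infty \frac{\sin ax-\sin bx}{\cosh\beta x}\,\frac{dx}{x}=2\tan^{-1}\frac{\exp\frac{a\pi}{2\beta}-\exp\frac{b\pi}{2\beta}}{1+\exp\frac{(a+b)\pi}{2\beta}}.$$
   Context: $\tan^{-1}$ denotes the arctangent function.
   Formalization: The formal theorem assumes β > 0 (with a, b real); for β < 0 the left side is even and the right side odd in β, so the formula fails when a ≠ b, and for β = 0 the right side is undefined. *)

(* Defs.v *)
From mathcomp Require Import all_boot all_order all_algebra.
From mathcomp Require Import all_classical all_reals all_analysis.
Import numFieldNormedType.Exports.

Set Implicit Arguments.
Unset Strict Implicit.
Unset Printing Implicit Defensive.

Local Open Scope ring_scope.

Definition cosh (R : realType) (x : R) : R := (expR x + expR (- x)) / 2.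

(* Main.v *)
Require Import Defs.
From mathcomp Require Import all_boot all_order all_algebra.
From mathcomp Require Import all_classical all_reals all_analysis.
From mathcomp Require Import measurable_realfun.
From mathcomp Require Import ring lra.
Import numFieldNormedType.Exports.
Import Order.TTheory GRing.Theory Num.Theory.

Local Open Scope classical_set_scope.
Local Open Scope ring_scope.

(* Differentiating under the integral sign in [a] reduces the claim to the cosine
   transform F(a) of 1 / cosh (b x).  Expanding 1 / cosh (b x) as a finite geometric
   series with remainder gives, with t = a / b and m = 2 k + 1,
     F(a) = (2 / b) S_N(t) + O(1 / N),   S_N(t) = sum_(k < N) (-1)^k m / (m^2 + t^2).
   Since (-1)^k m cosh (t pi / 2) / (m^2 + t^2) is the integral of
   cosh (t x) cos (m x) over [0, pi / 2], the Dirichlet kernel yields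
     cosh (t pi / 2) S_N(t) - S_N(0) = O(1 / N),
   so that cosh (t pi / 2) F(a) = F(0), and F(0) = pi / (2 b) by an explicit
   antiderivative. *)

(** * Derivative rules and comparison of increments *)

Section pointwise_derivatives.
Context {R : realType}.
Implicit Types (f g : R -> R) (x a b c : R).

(** The rules up to [is_derive_fsum] take functions in lambda form, so that [derive_elementary] can
    apply them by matching and build the derivative term along the way. *)
Lemma is_derive_fcst c x : is_derive x 1 (fun _ : R => c) 0.
Proof. exact: is_derive_cst. Qed.

Lemma is_derive_fid x : is_derive x 1 (fun y : R => y) 1.
Proof. exact: is_derive_id. Qed.

Lemma is_derive_fN f x a :
  is_derive x 1 f a -> is_derive x 1 (fun y => - f y) (- a).
Proof. exact: is_deriveN. Qed.

Lemma is_derive_fD f g x a b : is_derive x 1 f a -> is_derive x 1 g b ->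
  is_derive x 1 (fun y => f y + g y) (a + b).
Proof. exact: is_deriveD. Qed.

Lemma is_derive_fM f g x a b : is_derive x 1 f a -> is_derive x 1 g b ->
  is_derive x 1 (fun y => f y * g y) (f x * b + g x * a).
Proof. exact: is_deriveM. Qed.

Lemma is_derive_fV f x a : f x != 0 -> is_derive x 1 f a ->
  is_derive x 1 (fun y => (f y)^-1) (- f x ^- 2 * a).
Proof. exact: is_deriveV. Qed.

Lemma is_derive_fexpR f x a : is_derive x 1 f a ->
  is_derive x 1 (fun y => expR (f y)) (expR (f x) * a).
Proof. by move=> fa; apply: (is_derive1_comp (f := expR)). Qed.

Lemma is_derive_fsin f x a : is_derive x 1 f a ->
  is_derive x 1 (fun y => sin (f y)) (cos (f x) * a).
Proof. by move=> fa; apply: (is_derive1_comp (f := sin)). Qed.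

Lemma is_derive_fcos f x a : is_derive x 1 f a ->
  is_derive x 1 (fun y => cos (f y)) (- sin (f x) * a).
Proof. by move=> fa; apply: (is_derive1_comp (f := cos)). Qed.

Lemma is_derive_fatan f x a : is_derive x 1 f a ->
  is_derive x 1 (fun y => atan (f y)) ((1 + f x ^+ 2)^-1 * a).
Proof. by move=> fa; apply: (is_derive1_comp (f := atan)). Qed.

Lemma is_derive_fsum n (h : 'I_n -> R -> R) (dh : 'I_n -> R) x :
  (forall i, is_derive x 1 (h i) (dh i)) ->
  is_derive x 1 (fun y => \sum_(i < n) h i y) (\sum_(i < n) dh i).
Proof.
move=> hdh; have -> : (fun y => \sum_(i < n) h i y) = \sum_(i < n) h i.
  by apply/funext => y; rewrite fct_sumE.
exact: is_derive_sum.
Qed.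

Lemma is_derive_continuous f x a : is_derive x 1 f a -> {for x, continuous f}.
Proof.
by case=> df _; apply/differentiable_continuous/derivable1_diffP.
Qed.

Lemma is_derive_derive1 f x a : is_derive x 1 f a -> f^`()%classic x = a.
Proof. by move=> fa; rewrite derive1E derive_val. Qed.

Lemma derive_le_increment f g (df dg : R -> R) a b : a <= b ->
    (forall x, a <= x <= b -> is_derive x 1 f (df x)) ->
    (forall x, a <= x <= b -> is_derive x 1 g (dg x)) ->
    (forall x, a <= x <= b -> df x <= dg x) ->
  f b - f a <= g b - g a.
Proof.
move=> ab fE gE dfg.
have hE x : a <= x <= b -> is_derive x 1 (fun y => g y - f y) (dg x - df x).
  by move=> xab; apply: is_derive_fD; [exact: gE|apply: is_derive_fN; exact: fE].
have [||c] := MVT_segment (f := fun y => g y - f y) (df := fun x => dg x - df x) ab.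
- move=> x; rewrite in_itv/= => /andP[ax xb]; apply: hE.
  by rewrite (ltW ax) (ltW xb).
- apply: derivable_within_continuous => x; rewrite in_itv/= => xab.
  by have [] := hE x xab.
rewrite in_itv/= => cab hh.
have : 0 <= (dg c - df c) * (b - a).
  by rewrite mulr_ge0// subr_ge0// dfg.
rewrite -hh; lra.
Qed.

(** Stands in for the estimate of an integral of [df] by an integral of [dg]: every estimate on
    [0, pi / 2] below is made on antiderivatives through it. Both [f] and [- f] grow no faster than
    [g]. *)
Lemma derive_le_dist f g (df dg : R -> R) a b : a <= b ->
    (forall x, a <= x <= b -> is_derive x 1 f (df x)) ->
    (forall x, a <= x <= b -> is_derive x 1 g (dg x)) ->
    (forall x, a <= x <= b -> `|df x| <= dg x) ->
  `|f b - f a| <= g b - g a.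
Proof.
move=> ab fE gE dfg; rewrite ler_norml; apply/andP; split; last first.
  by apply: derive_le_increment ab fE gE _ => x /dfg; rewrite ler_norml => /andP[].
have := @derive_le_increment (fun y => - f y) g (fun y => - df y) dg a b ab.
have fNE x : a <= x <= b -> is_derive x 1 (fun y => - f y) (- df x).
  by move=> /fE; exact: is_derive_fN.
move=> /(_ fNE gE) H.
have : - f b - - f a <= g b - g a.
  by apply: H => x /dfg; rewrite ler_norml => /andP[? _]; lra.
lra.
Qed.

End pointwise_derivatives.

(* [apply] would let type class resolution choose the derivatives, as uncontrolled
   functions of the library instances. *)
Ltac derive_elementary := first
  [ eassumption
  | notypeclasses refine (is_derive_fcst _ _)
  | notypeclasses refine (is_derive_fid _)
  | notypeclasses refine (is_derive_fN _ _ _ _)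
  | notypeclasses refine (is_derive_fD _ _ _ _ _ _ _)
  | notypeclasses refine (is_derive_fM _ _ _ _ _ _ _)
  | notypeclasses refine (is_derive_fV _ _ _ _ _)
  | notypeclasses refine (is_derive_fexpR _ _ _ _)
  | notypeclasses refine (is_derive_fsin _ _ _ _)
  | notypeclasses refine (is_derive_fcos _ _ _ _)
  | notypeclasses refine (is_derive_fatan _ _ _ _)
  | notypeclasses refine (is_derive_fsum _ _ _ _ _); intro ].

(** * Hyperbolic functions and their derivatives *)

Section hyperbolic_functions.
Context {R : realType}.
Implicit Types (f : R -> R) (x a : R).

Definition sinh x : R := (expR x - expR (- x)) / 2.

Lemma is_derive_fsinh f x a : is_derive x 1 f a ->
  is_derive x 1 (fun y => sinh (f y)) (cosh (f x) * a).
Proof.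
move=> fa; rewrite /sinh /cosh.
by notypeclasses refine (trigger_derive _ _); [repeat derive_elementary|cbv beta; ring].
Qed.

Lemma is_derive_fcosh f x a : is_derive x 1 f a ->
  is_derive x 1 (fun y => cosh (f y)) (sinh (f x) * a).
Proof.
move=> fa; rewrite /sinh /cosh.
by notypeclasses refine (trigger_derive _ _); [repeat derive_elementary|cbv beta; ring].
Qed.

End hyperbolic_functions.

Ltac derive_step := first
  [ notypeclasses refine (is_derive_fsinh _ _ _ _)
  | notypeclasses refine (is_derive_fcosh _ _ _ _)
  | derive_elementary ].

Ltac compute_derive :=
  notypeclasses refine (trigger_derive _ _); [repeat derive_step|cbv beta].

(** * Alternating sums over odd integers and the Dirichlet kernel *)

Section alternating_sums.
Context {R : realType}.
Implicit Types (t x : R) (N k : nat).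

Lemma sinh0 : sinh 0 = 0 :> R.
Proof. by rewrite /sinh oppr0 subrr mul0r. Qed.

Lemma cosh0 : cosh 0 = 1 :> R.
Proof. by rewrite /cosh oppr0 expR0; field. Qed.

Lemma cosh_gt0 x : 0 < cosh x.
Proof. by rewrite divr_gt0// addr_gt0// expR_gt0. Qed.

Lemma cosh_le_expR x : cosh x <= expR `|x|.
Proof.
rewrite /cosh ler_pdivrMr// mulr_natr mulr2n lerD// ler_expR ?ler_norm//.
by rewrite -normrN ler_norm.
Qed.

Lemma sin_pihalf_ge0 x : 0 <= x <= pi / 2 -> 0 <= sin x.
Proof.
move=> /andP[x0 xpi]; apply: sin_ge0_pi; rewrite x0/=.
by have := @pi_gt0 R; lra.
Qed.

(** Write x = x cos x + x (1 - cos x). The first term is at most sin x by comparing derivatives; the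
    second is at most 2 sin x, as x <= 2 and sin x + cos x >= 1 on this interval. This lets a factor
    x absorb the 1 / sin x of [norm_kern_le]. *)
Lemma le3sin x : 0 <= x <= pi / 2 -> x <= 3 * sin x.
Proof.
move=> xpi; have /andP[x0 xp] := xpi.
have s0 := sin_pihalf_ge0 _ xpi.
have c0 : 0 <= cos x by apply: cos_ge0_pihalf; rewrite xp andbT; have := @pi_gt0 R; lra.
have cs : x * cos x <= sin x.
  have := @derive_le_increment R (fun y => y * cos y) sin
    (fun y => cos y - y * sin y) cos 0 x x0.
  rewrite mul0r sin0 !subr0; apply.
  - by move=> y _; compute_derive; ring.
  - move=> y /andP[y0 yx]; rewrite gerBl mulr_ge0//.
    by apply: sin_pihalf_ge0; rewrite y0 (le_trans yx).
have sc1 : 1 - cos x <= sin x.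
  have := cos2Dsin2 x; move: (sin x) (cos x) s0 c0 => s c s0 c0 sc1.
  by nra.
have x2 : x <= 2 by have := @pihalf_lt2 R; lra.
nra.
Qed.

Lemma norm_sinh_le t x : 0 <= x <= pi / 2 ->
  `|sinh (t * x)| <= `|t| * expR (2 * `|t|) * x.
Proof.
move=> /andP[x0 xpi].
have := @derive_le_dist R (fun y => sinh (t * y)) (fun y => `|t| * expR (2 * `|t|) * y)
   (fun y => cosh (t * y) * t) (fun y => `|t| * expR (2 * `|t|)) 0 x x0.
rewrite !mulr0 sinh0 !subr0; apply.
- by move=> y _; compute_derive; ring.
- by move=> y _; compute_derive; ring.
- move=> y /andP[y0 yx]; rewrite normrM mulrC ler_wpM2l//.
  rewrite gtr0_norm ?cosh_gt0// (le_trans (cosh_le_expR _))// ler_expR.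
  rewrite normrM mulrC ler_wpM2r// ger0_norm//.
  by have := @pihalf_lt2 R; lra.
Qed.

Definition oddr k : R := k.*2.+1%:R.

Lemma oddr_gt0 k : 0 < oddr k. Proof. by rewrite ltr0n. Qed.

Lemma oddr_neq0 k : oddr k != 0. Proof. by rewrite gt_eqF// oddr_gt0. Qed.

Lemma oddrE k : oddr k = 2 * k%:R + 1.
Proof. by rewrite /oddr -natr1 -muln2 natrM mulrC. Qed.

Lemma trig_oddr_pihalf k :
  sin (oddr k * (pi / 2)) = (-1) ^+ k /\ cos (oddr k * (pi / 2)) = 0.
Proof.
elim: k => [|k [IHs IHc]]; first by rewrite /oddr mul1r sin_pihalf cos_pihalf.
have -> : oddr k.+1 * (pi / 2) = oddr k * (pi / 2) + pi :> R.
  by rewrite !oddrE -natr1; field.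
by rewrite sinDpi cosDpi IHs IHc exprS mulN1r oppr0.
Qed.

(** Telescoping of 2 sin x cos (m x) = sin ((m + 1) x) - sin ((m - 1) x) over odd m. *)
Lemma sum_cos_oddr N x :
  sin x * (\sum_(k < N) cos (oddr k * x)) = sin (2 * N%:R * x) / 2.
Proof.
elim: N => [|N IHN]; first by rewrite big_ord0 !(mulr0, mul0r) sin0 mul0r.
rewrite big_ord_recr/= mulrDr IHN.
have -> : 2 * N.+1%:R * x = oddr N * x + x by rewrite oddrE -natr1; ring.
have -> : 2 * N%:R * x = oddr N * x - x by rewrite oddrE; ring.
by rewrite !sinD sinN cosN; field.
Qed.

(** The integral over [x, pi / 2] of the Dirichlet sum of the cos (m y), in closed form: (-1)^k is
    the value of sin (m y) at pi / 2. *)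
Definition kern N x : R := \sum_(k < N) ((-1) ^+ k - sin (oddr k * x)) / oddr k.

Lemma is_derive_kern N x :
  is_derive x 1 (kern N) (- \sum_(k < N) cos (oddr k * x)).
Proof.
rewrite /kern; compute_derive.
by rewrite -sumrN; apply: eq_bigr => k _; have := oddr_neq0 k => ?; field.
Qed.

Lemma kern_pihalf N : kern N (pi / 2) = 0.
Proof.
by apply: big1 => k _; have [-> _] := trig_oddr_pihalf k; rewrite subrr mul0r.
Qed.

(* Integration by parts for the Dirichlet kernel
   [\sum_(k < N) cos (oddr k * x) = sin (2 N x) / (2 sin x)] on [x, pi / 2],
   carried out on antiderivatives. *)
Lemma norm_kern_le N x : (0 < N)%N -> 0 < x <= pi / 2 ->
  `|kern N x| <= (2 * N%:R * sin x)^-1.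
Proof.
move=> N0 /andP[x0 xpi].
have n0 : 0 < N%:R :> R by rewrite ltr0n.
have s_gt0 y : x <= y <= pi / 2 -> 0 < sin y.
  move=> /andP[xy ypi]; apply: sin_gt0_pi; rewrite (lt_le_trans x0 xy)/=.
  by have := @pi_gt0 R; lra.
have := @derive_le_dist R
  (fun y => kern N y - cos (2 * N%:R * y) * (4 * N%:R * sin y)^-1)
  (fun y => - (4 * N%:R * sin y)^-1)
  (fun y => cos (2 * N%:R * y) * cos y / (4 * N%:R * sin y ^+ 2))
  (fun y => cos y / (4 * N%:R * sin y ^+ 2)) x (pi / 2) xpi.
have den y : x <= y <= pi / 2 -> 4 * N%:R * sin y != 0.
  by move=> /s_gt0 sy; rewrite gt_eqF// !mulr_gt0.
rewrite kern_pihalf sub0r sin_pihalf mulr1.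
have c1 : `|cos (2 * N%:R * (pi / 2))| <= 1 :> R by exact: cos_max.
have c2 : `|cos (2 * N%:R * x)| <= 1 by exact: cos_max.
have sx := s_gt0 x; rewrite lexx xpi in sx; have {}sx := sx isT.
move=> H; have {H} : `|- (cos (2 * N%:R * (pi / 2)) / (4 * N%:R))
     - (kern N x - cos (2 * N%:R * x) / (4 * N%:R * sin x))| <=
  - (4 * N%:R)^-1 - - (4 * N%:R * sin x)^-1.
  apply: H.
  - move=> y xy; have K := is_derive_kern N y; have dy := den _ xy.
    have sy := s_gt0 _ xy.
    compute_derive => //.
    have -> : \sum_(k < N) cos (oddr k * y) = sin (2 * N%:R * y) / 2 / sin y.
      by rewrite -sum_cos_oddr mulrC mulKf// gt_eqF.
    by field; rewrite gt_eqF//= gt_eqF.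
  - move=> y xy; have dy := den _ xy; have sy := s_gt0 _ xy.
    compute_derive => //.
    by field; rewrite gt_eqF//= gt_eqF.
  - move=> y xy; have sy := s_gt0 _ xy.
    have cy : 0 <= cos y.
      move: xy => /andP[xy ypi]; apply: cos_ge0_pihalf; rewrite ypi andbT.
      by have := @pi_gt0 R; lra.
    have q0 : 0 <= cos y / (4 * N%:R * sin y ^+ 2).
      by rewrite divr_ge0// !mulr_ge0// ?exprn_ge0// ltW.
    rewrite -mulrA normrM (ger0_norm q0) ler_piMl//; exact: cos_max.
(* One half of the bound pays for the boundary term at x. The other half, 1 / (4 N sin x), covers
   the increment just estimated together with the boundary term at pi / 2, since the 1 / (4 N)
   contributions cancel. *)
have -> : (2 * N%:R * sin x)^-1 = 2 * (4 * N%:R * sin x)^-1.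
  by field; rewrite gt_eqF//= gt_eqF.
have b1 : `|cos (2 * N%:R * (pi / 2)) / (4 * N%:R)| <= (4 * N%:R)^-1 :> R.
  have j0 : 0 <= (4 * N%:R)^-1 :> R by rewrite invr_ge0 mulr_ge0.
  by rewrite normrM (ger0_norm j0) ler_piMl.
have b2 : `|cos (2 * N%:R * x) / (4 * N%:R * sin x)| <= (4 * N%:R * sin x)^-1.
  have j0 : 0 <= (4 * N%:R * sin x)^-1 by rewrite invr_ge0 !mulr_ge0// ltW.
  by rewrite normrM (ger0_norm j0) ler_piMl.
move: b1 b2; rewrite !ler_norml => /andP[? ?] /andP[? ?] /andP[? ?].
by apply/andP; split; lra.
Qed.

(** Partial sums of the partial fraction expansion of (pi / 4) / cosh (pi t / 2). *)
Definition sech_sum N t : R :=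
  \sum_(k < N) (-1) ^+ k * oddr k / (oddr k ^+ 2 + t ^+ 2).

Lemma oddr_sqr_gt0 k t : 0 < oddr k ^+ 2 + t ^+ 2.
Proof. by rewrite ltr_pwDl ?sqr_ge0// exprn_gt0// oddr_gt0. Qed.

(* The function differentiated below interpolates between
   [sech_sum N 0] at [0] and [cosh (t * (pi / 2)) * sech_sum N t] at [pi / 2],
   with derivative [t * sinh (t * x) * kern N x = O(1 / N)]. *)
Lemma sech_sum_cvg t : exists C : R, forall N, (0 < N)%N ->
  `|cosh (t * (pi / 2)) * sech_sum N t - sech_sum N 0| <= C / N%:R.
Proof.
(* The bound of [norm_sinh_le] with x replaced by 3 sin x, times |t|; the sin x cancels against 1 /
   (2 N sin x), which leaves the division by 2. *)
set M : R := `|t| * (`|t| * expR (2 * `|t|) * 3) / 2.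
exists (M * (pi / 2)) => N N0.
have n0 : 0 < N%:R :> R by rewrite ltr0n.
(* The k-th summand is the antiderivative of cosh (t x) cos (m x) that vanishes at 0. Adding cosh (t
   x) [kern N x] cancels the Dirichlet sum in the derivative. *)
pose Q x := \sum_(k < N) (t * sinh (t * x) * cos (oddr k * x) +
   oddr k * cosh (t * x) * sin (oddr k * x)) / (oddr k ^+ 2 + t ^+ 2).
have QE x : is_derive x 1 Q (cosh (t * x) * \sum_(k < N) cos (oddr k * x)).
  compute_derive.
  rewrite mulr_sumr; apply: eq_bigr => k _.
  by move: (oddr k) (oddr_sqr_gt0 k t) => m m0; field; rewrite gt_eqF.
have pi0 : 0 <= pi / 2 :> R by rewrite divr_ge0// pi_ge0.
have := @derive_le_dist R (fun x => Q x + cosh (t * x) * kern N x)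
  (fun x => M / N%:R * x) (fun x => t * sinh (t * x) * kern N x)
  (fun=> M / N%:R) 0 (pi / 2) pi0.
have Q0 : Q 0 = 0.
  by apply: big1 => k _; rewrite !mulr0 sinh0 sin0 !(mulr0, mul0r, addr0).
have K0 : kern N 0 = sech_sum N 0.
  apply: eq_bigr => k _; rewrite mulr0 sin0 subr0 expr0n addr0.
  by move: (oddr k) (oddr_neq0 k) => m m0; field.
have Qpi : Q (pi / 2) = cosh (t * (pi / 2)) * sech_sum N t.
  rewrite mulr_sumr; apply: eq_bigr => k _.
  by have [-> ->] := trig_oddr_pihalf k; ring.
rewrite kern_pihalf Q0 K0 Qpi !(mulr0, addr0, add0r) cosh0 mul1r subr0.
have -> : M * (pi / 2) / N%:R = M / N%:R * (pi / 2) by field; rewrite gt_eqF.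
apply.
- move=> x _; have := QE x; have := is_derive_kern N x => K Qx.
  by compute_derive; ring.
- by move=> x _; compute_derive; ring.
(* The kernel bound is singular at 0, but there the factor sinh (t x) vanishes. *)
- move=> x /andP[]; rewrite le_eqVlt => /predU1P[<- _|x0 xpi].
    rewrite mulr0 sinh0 mulr0 mul0r normr0 divr_ge0//.
    by rewrite divr_ge0// !mulr_ge0// expR_ge0.
  have x0pi : 0 < x <= pi / 2 by rewrite x0.
  have xx0pi : 0 <= x <= pi / 2 by rewrite ltW.
  have sx : 0 < sin x by apply: sin_gt0_pi; rewrite x0/=; have := @pi_gt0 R; lra.
  have l3 := le3sin _ xx0pi.
  have -> : M / N%:R = `|t| * (`|t| * expR (2 * `|t|) * (3 * sin x)) * (2 * N%:R * sin x)^-1.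
    by rewrite /M; field; rewrite gt_eqF//= gt_eqF.
  rewrite normrM [X in X * _]normrM ler_pM//; last exact: norm_kern_le.
  rewrite ler_wpM2l// (le_trans (norm_sinh_le _ _ xx0pi))//.
  by rewrite ler_wpM2l// mulr_ge0// expR_ge0.
Qed.

End alternating_sums.

(** * Integrals over the half line from antiderivatives *)

Section half_line_integrals.
Context {R : realType}.
Implicit Types (f g F : R -> R) (a b c t x y : R) (N k : nat).

Local Notation mu := (@lebesgue_measure R).
Local Notation D := (`]0%R, +oo[%classic : set R).

Lemma measurable_halfline : measurable (D : set (measurableTypeR R)).
Proof. exact: measurable_itv. Qed.

Lemma continuous_measurable_halfline f :
  (forall x, 0 < x -> {for x, continuous f}) -> measurable_fun D f.
Proof.
move=> cf; apply: open_continuous_measurable_fun => // x.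
by rewrite inE/= in_itv/= andbT => /cf.
Qed.

Lemma expRNM_cvg0 c : 0 < c -> expR (- (c * x)) @[x --> +oo] --> 0.
Proof.
move=> c0; have cx : c * x @[x --> +oo] --> +oo by exact: (gt0_cvgMry c0 cvg_id).
exact: (cvg_comp (fun x => c * x) (fun x => expR (- x)) cx (@cvgr_expR R)).
Qed.

(** For a nonnegative integrand the fundamental theorem needs no prior integrability, and the finite
    value it gives then proves integrability. The derivative [f'] serves to make [f] continuous,
    hence measurable. *)
Lemma halfline_FTC (f F f' : R -> R) (l : R) :
    (forall x, 0 <= x -> 0 <= f x) ->
    (forall x, is_derive x 1 f (f' x)) ->
    (forall x, is_derive x 1 F (f x)) ->
    F x @[x --> +oo] --> l ->
  mu.-integrable D (EFin \o f) /\ \int[mu]_(x in D) f x = l - F 0.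
Proof.
move=> f0 f'E FE Fl.
have cf x : {for x, continuous f} := is_derive_continuous _ _ _ (f'E x).
have mf : measurable_fun D f by apply: continuous_measurable_halfline => x _.
have I : (\int[mu]_(x in D) (f x)%:E = l%:E - (F 0)%:E)%E.
  rewrite integral_itv_obnd_cbnd//; last exact/measurable_EFinP.
  apply: ge0_continuous_FTC2y => //.
  - by apply: continuous_subspaceT; exact: cf.
  - by apply: cvg_at_right_filter; exact: is_derive_continuous (FE 0).
  - by move=> x _; exact: is_derive_derive1 (FE x).
split; last by rewrite /Rintegral I -EFinB.
apply/integrableP; split; first exact/measurable_EFinP.
rewrite (_ : integral _ _ _ = \int[mu]_(x in D) (f x)%:E)%E.
  by rewrite I -EFinB ltry.
apply: eq_integral => x; rewrite inE/= in_itv/= andbT => x0.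
by rewrite ger0_norm// f0// ltW.
Qed.

Lemma integral_expRN c : 0 < c ->
  mu.-integrable D (EFin \o (fun x => expR (- (c * x)))) /\
  \int[mu]_(x in D) expR (- (c * x)) = c^-1.
Proof.
move=> c0; have cN0 : c != 0 by rewrite gt_eqF.
have [||||I ->] := @halfline_FTC (fun x => expR (- (c * x)))
  (fun x => - c^-1 * expR (- (c * x))) (fun x => - c * expR (- (c * x))) (- c^-1 * 0).
- by move=> x _; exact: expR_ge0.
- by move=> x; compute_derive; ring.
- by move=> x; compute_derive; field.
- by apply: cvgMl_tmp; exact: expRNM_cvg0.
by split => //; rewrite !mulr0 oppr0 expR0; ring.
Qed.

Lemma integrable_expRN_bound f K c : 0 < c -> measurable_fun D f ->
  (forall x, 0 < x -> `|f x| <= K * expR (- (c * x))) ->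
  mu.-integrable D (EFin \o f).
Proof.
move=> c0 mf fK; have [I _] := integral_expRN c c0.
apply: (@le_integrable _ _ _ mu D measurable_halfline _
  (fun x => K%:E * (EFin \o (fun x => expR (- (c * x)))) x)%E).
- exact/measurable_EFinP.
- move=> x; rewrite /= in_itv/= andbT => x0.
  by rewrite lee_fin (le_trans (fK x x0))// ler_norm.
- exact: integrableZl.
Qed.

(** The integrand changes sign, so [halfline_FTC] is applied to (cos (a x) + 1) expR (- (c x)),
    which is nonnegative, and the known integral 1 / c is subtracted. *)
Lemma integral_cos_expRN a c : 0 < c ->
  mu.-integrable D (EFin \o (fun x => cos (a * x) * expR (- (c * x)))) /\
  \int[mu]_(x in D) (cos (a * x) * expR (- (c * x))) = c / (c ^+ 2 + a ^+ 2).
Proof.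
move=> c0; have cN0 : c != 0 by rewrite gt_eqF.
have d0 : 0 < c ^+ 2 + a ^+ 2 by rewrite ltr_pwDl ?sqr_ge0// exprn_gt0.
have [Ie Ee] := integral_expRN c c0.
have Ic : mu.-integrable D (EFin \o (fun x => cos (a * x) * expR (- (c * x)))).
  apply: (@integrable_expRN_bound _ 1 c c0).
    apply: continuous_measurable_halfline => x _.
    by notypeclasses refine (is_derive_continuous _ _ _ _); last by repeat derive_step.
  by move=> x _; rewrite normrM (ger0_norm (expR_ge0 _)) ler_wpM2r ?expR_ge0// cos_max.
split => //.
have [||||I] := @halfline_FTC (fun x => cos (a * x) * expR (- (c * x)) + expR (- (c * x)))
  (fun x => expR (- (c * x)) *
     ((a * sin (a * x) - c * cos (a * x)) / (c ^+ 2 + a ^+ 2) - c^-1))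
  (fun x => - a * sin (a * x) * expR (- (c * x)) - c * cos (a * x) * expR (- (c * x))
     - c * expR (- (c * x))) 0.
- move=> x _; have : -1 <= cos (a * x) by rewrite cos_geN1.
  have := expR_ge0 (- (c * x)); nra.
- by move=> x; compute_derive; ring.
- by move=> x; compute_derive; field; rewrite cN0 gt_eqF.
(* K bounds the trigonometric factor of the antiderivative, so that the exponential drives it to
   0. *)
- pose K := (`|a| + `|c|) / (c ^+ 2 + a ^+ 2) + `|c^-1|.
  apply: norm_cvg0.
  apply: (@squeeze_cvgr _ _ _ _ (fun=> 0) (fun x => K * expR (- (c * x)))).
  + apply: nearW => x; rewrite normr_ge0/= mulrC normrM (ger0_norm (expR_ge0 _)).
    rewrite ler_wpM2r ?expR_ge0// (le_trans (ler_normB _ _))// lerD2r.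
    rewrite normrM (@ger0_norm _ (_^-1)) ?invr_ge0 ?(ltW d0)//.
    rewrite ler_wpM2r ?invr_ge0 ?(ltW d0)// (le_trans (ler_normB _ _))//.
    by rewrite lerD// normrM ler_piMr ?sin_max ?cos_max.
  + exact: cvg_cst.
  + by rewrite -[X in _ --> X](mulr0 K); apply: cvgMl_tmp; exact: expRNM_cvg0.
rewrite RintegralD// Ee !mulr0 sin0 cos0 oppr0 expR0 => E.
rewrite -[LHS](addrK c^-1) E; field.
by rewrite cN0 gt_eqF.
Qed.

(** * The cosine transform of 1 / cosh (b x) *)

Lemma sech_le b x : 0 <= (cosh (b * x))^-1 <= 2 * expR (- (b * x)).
Proof.
rewrite invr_ge0 ltW ?cosh_gt0//=.
rewrite -lef_pV2 ?posrE ?invr_gt0 ?cosh_gt0 ?mulr_gt0 ?expR_gt0//.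
rewrite invrK invfM -expRN opprK /cosh mulrC ler_wpM2r// lerDl.
exact: expR_ge0.
Qed.

Lemma integral_sech b : 0 < b ->
  \int[mu]_(x in D) (cosh (b * x))^-1 = pi / (2 * b).
Proof.
move=> b0; have bN0 : b != 0 by rewrite gt_eqF.
have cN0 x : cosh x != 0 by rewrite gt_eqF// cosh_gt0.
(* With e = expR (- (b x)), 1 / cosh (b x) = 2 e / (1 + e^2), hence the arctangent; it runs from pi
   / 4 at 0 to 0 at infinity. *)
have [||||_ ->] := @halfline_FTC (fun x => (cosh (b * x))^-1)
  (fun x => - (2 / b) * atan (expR (- (b * x))))
  (fun x => - cosh (b * x) ^- 2 * (sinh (b * x) * b)) (- (2 / b) * atan 0).
- by move=> x _; have /andP[] := sech_le b x.
- by move=> x; compute_derive; [|ring].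
- move=> x; compute_derive; rewrite /cosh (expRN (b * x)).
  have := expR_gt0 (b * x); move: (expR (b * x)) => e e0.
  have e2 : 0 < e ^+ 2 + 1 by rewrite addr_gt0// exprn_gt0.
  by field; rewrite bN0 !gt_eqF// ?addr_gt0 ?exprn_gt0// addrC.
- apply: cvgMl_tmp.
  apply: (cvg_comp (fun x => expR (- (b * x))) atan (expRNM_cvg0 b b0)).
  exact: continuous_atan.
by rewrite atan0 !mulr0 oppr0 expR0 atan1; field.
Qed.

(* Tail of the geometric series [1 / cosh y = 2 \sum_k (-1)^k expR (- (oddr k * y))]. *)
Definition sech_tail N a b x : R :=
  cos (a * x) * expR (- (2 * N%:R * b * x)) / cosh (b * x).

Lemma integrable_sech_tail N a b : 0 < b ->
  mu.-integrable D (EFin \o sech_tail N a b).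
Proof.
move=> b0; apply: (@integrable_expRN_bound _ 2 b b0).
  apply: continuous_measurable_halfline => x _.
  rewrite /sech_tail; notypeclasses refine (is_derive_continuous _ _ _ _); last first.
    by repeat derive_step; rewrite gt_eqF// cosh_gt0.
move=> x x0; have /andP[s0 s2] := sech_le b x.
rewrite /sech_tail normrM (ger0_norm s0) (le_trans _ s2)// ler_piMl//.
rewrite normrM (ger0_norm (expR_ge0 _)) mulr_ile1 ?expR_ge0 ?cos_max//.
by rewrite -expR0 ler_expR oppr_le0 !mulr_ge0// ltW.
Qed.

(** As |cos| <= 1 <= cosh, the integrand is dominated by expR (- (2 N b x)), whose integral is 1 /
    (2 N b). *)
Lemma norm_integral_sech_tail N a b : 0 < b -> (0 < N)%N ->
  `|\int[mu]_(x in D) sech_tail N a b x| <= (2 * b)^-1 / N%:R.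
Proof.
move=> b0 N0; have n0 : 0 < N%:R :> R by rewrite ltr0n.
have nb0 : 0 < 2 * N%:R * b by rewrite !mulr_gt0.
have [I E] := integral_expRN _ nb0.
have IT := integrable_sech_tail N a b b0.
rewrite (le_trans (le_normr_Rintegral measurable_halfline IT))//.
rewrite -invfM (_ : 2 * b * N%:R = 2 * N%:R * b); last by ring.
rewrite -E; apply: le_Rintegral => //.
  by have := integrable_norm IT.
move=> x _; rewrite /sech_tail normrM normrM (ger0_norm (expR_ge0 _)).
have ch1 : 1 <= cosh (b * x).
  rewrite /cosh expRN; have := expR_gt0 (b * x).
  move: (expR _) => e e0; rewrite ler_pdivlMr// mul1r.
  rewrite -subr_ge0 (_ : e + e^-1 - 2 = (e - 1) ^+ 2 / e).
    by rewrite divr_ge0// ?sqr_ge0// ltW.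
  by field; rewrite gt_eqF.
rewrite (@ger0_norm _ (_^-1)) ?invr_ge0 ?(le_trans _ ch1)//.
rewrite mulrAC ler_piMl ?expR_ge0// mulr_ile1 ?invr_ge0 ?(le_trans _ ch1) ?cos_max//.
by rewrite invf_le1// (lt_le_trans _ ch1).
Qed.

(** With y = b x, expR (- 2 N y) + expR (- 2 (N + 1) y) = 2 expR (- (2 N + 1) y) cosh y: the
    denominator cancels and [integral_cos_expRN] applies. *)
Lemma integral_sech_tailS N a b : 0 < b ->
  \int[mu]_(x in D) sech_tail N a b x + \int[mu]_(x in D) sech_tail N.+1 a b x =
  2 / b * (oddr N / (oddr N ^+ 2 + (a / b) ^+ 2)).
Proof.
move=> b0; have c0 : 0 < oddr N * b by rewrite mulr_gt0// oddr_gt0.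
have [I E] := integral_cos_expRN a _ c0.
have H1 := integrable_sech_tail N a b b0; have H2 := integrable_sech_tail N.+1 a b b0.
rewrite -RintegralD//.
transitivity (\int[mu]_(x in D) (2 * (cos (a * x) * expR (- (oddr N * b * x))))).
  apply: eq_Rintegral => x _; rewrite /sech_tail.
  have -> : - (2 * N%:R * b * x) = - (oddr N * b * x) + b * x by rewrite oddrE; ring.
  have -> : - (2 * N.+1%:R * b * x) = - (oddr N * b * x) - b * x.
    by rewrite oddrE -natr1; ring.
  rewrite !expRD -mulrDl -mulrDr -mulrDr.
  have -> : expR (b * x) + expR (- (b * x)) = 2 * cosh (b * x) by rewrite /cosh; field.
  by move: (cosh (b * x)) (cosh_gt0 (b * x)) => h h0; field; rewrite gt_eqF.
rewrite RintegralZl//.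
rewrite E; have := oddr_sqr_gt0 N (a / b); have := oddr_gt0 (R := R) N.
move: (oddr N) => m m0 d0.
have d1 : 0 < (m * b) ^+ 2 + a ^+ 2.
  by rewrite ltr_pwDl ?sqr_ge0// exprn_gt0// mulr_gt0.
have bN0 : b != 0 by rewrite gt_eqF.
have -> : m ^+ 2 + (a / b) ^+ 2 = ((m * b) ^+ 2 + a ^+ 2) / b ^+ 2 by field.
by field; rewrite bN0 gt_eqF.
Qed.

(** The left-hand side is the full cosine transform. Solving [integral_sech_tailS] for the later
    tail flips its sign at each step, which produces the alternating sum. *)
Lemma integral_sech_tail0 N a b : 0 < b ->
  \int[mu]_(x in D) sech_tail 0 a b x =
  2 / b * sech_sum N (a / b) + (-1) ^+ N * \int[mu]_(x in D) sech_tail N a b x.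
Proof.
move=> b0; elim: N => [|N IHN].
  by rewrite /sech_sum big_ord0 mulr0 add0r mul1r.
have := integral_sech_tailS N a b b0 => /(canRL (addrK _)) EN.
rewrite IHN EN /sech_sum big_ord_recr/= [(-1) ^+ N.+1]exprS -(mulrA _ (oddr N)).
by set q := oddr N / _; ring.
Qed.

Lemma integral_cos_sech a b : 0 < b ->
  \int[mu]_(x in D) (cos (a * x) / cosh (b * x)) =
  pi / (2 * b) / cosh (a * pi / (2 * b)).
Proof.
move=> b0; have bN0 : b != 0 by rewrite gt_eqF.
set F : R -> R := fun a => \int[mu]_(x in D) sech_tail 0 a b x.
have FE a' : \int[mu]_(x in D) (cos (a' * x) / cosh (b * x)) = F a'.
  apply: eq_Rintegral => x _.
  by rewrite /sech_tail mulr0 !mul0r oppr0 expR0 mulr1.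
rewrite FE; have F0 : F 0 = pi / (2 * b).
  rewrite -FE -integral_sech//; apply: eq_Rintegral => x _.
  by rewrite mul0r cos0 mul1r.
pose t := a / b; pose h := cosh (t * (pi / 2)).
have [C HC] := sech_sum_cvg t.
have key : h * F a - F 0 = 0.
  apply/eqP; rewrite -normr_le0; apply/ler_addgt0Pr => e e0; rewrite add0r.
  (* The quantity to annihilate does not depend on N, yet is at most K / N for every positive N: C
     comes from [sech_sum_cvg], and the two tails enter with weights h and 1. *)
  pose K := `|2 / b| * C + (h + 1) * (2 * b)^-1.
  pose N := (Num.truncn (K / e)).+1.
  have N0 : 0 < N%:R :> R by rewrite ltr0n.
  apply: (@le_trans _ _ (K / N%:R)); last first.
    rewrite ler_pdivrMr// mulrC -ler_pdivrMr// ltW//; exact: truncnS_gt.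
  rewrite /F (integral_sech_tail0 N)// (integral_sech_tail0 N 0)// mul0r.
  have e1 : `|(-1) ^+ N| = 1 :> R by rewrite normrX normrN1 expr1n.
  set T1 := \int[mu]_(x in D) _; set T2 := \int[mu]_(x in D) _.
  have t1 : `|T1| <= (2 * b)^-1 / N%:R by exact: norm_integral_sech_tail.
  have t2 : `|T2| <= (2 * b)^-1 / N%:R by exact: norm_integral_sech_tail.
  have -> : h * (2 / b * sech_sum N (a / b) + (-1) ^+ N * T1) -
    (2 / b * sech_sum N 0 + (-1) ^+ N * T2) =
    2 / b * (h * sech_sum N t - sech_sum N 0) + h * ((-1) ^+ N * T1) - (-1) ^+ N * T2.
    rewrite -/t; clearbody h T1 T2.
    by move: (sech_sum N t) (sech_sum N 0) => s1 s0; ring.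
  have h0 : 0 < h by exact: cosh_gt0.
  have -> : K / N%:R = `|2 / b| * (C / N%:R) + h * ((2 * b)^-1 / N%:R) + (2 * b)^-1 / N%:R.
    by rewrite /K; ring.
  rewrite (le_trans (ler_normB _ _))// lerD//; last by rewrite normrM e1 mul1r.
  rewrite (le_trans (ler_normD _ _))// lerD//.
    by rewrite normrM ler_wpM2l// HC.
  by rewrite normrM (gtr0_norm h0) ler_wpM2l ?(ltW h0)// normrM e1 mul1r.
have -> : a * pi / (2 * b) = t * (pi / 2) by rewrite /t; field.
rewrite -F0 -/h; have -> : F 0 = h * F a by lra.
by rewrite mulrAC divff ?mul1r// gt_eqF// cosh_gt0.
Qed.

(** * From the cosine transform to the sine integral, and the arctangent formula *)

Lemma norm_sin_le x : `|sin x| <= `|x|.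
Proof.
wlog x0 : x / 0 <= x.
  move=> H; have [/H//|/ltW x0] := leP 0 x.
  by rewrite -[leLHS]normrN -sinN -[leRHS]normrN H// oppr_ge0.
have := @derive_le_dist R sin (fun y => y) cos (fun=> 1) 0 x x0.
rewrite sin0 !subr0 (ger0_norm x0); apply => y _; last exact: cos_max.
all: typeclasses eauto.
Qed.

(** The singularity at 0 is removable, since |sin (a x) / x| <= |a|; decay at infinity comes from
    [sech_le]. *)
Lemma integrable_sin_sech a b : 0 < b ->
  mu.-integrable D (EFin \o (fun x => sin (a * x) / cosh (b * x) / x)).
Proof.
move=> b0; apply: (@integrable_expRN_bound _ (`|a| * 2) b b0).
  apply: continuous_measurable_halfline => x x0.
  notypeclasses refine (is_derive_continuous _ _ _ _); last first.
    by repeat derive_step; rewrite gt_eqF// cosh_gt0.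
move=> x x0; have /andP[s0 s2] := sech_le b x.
rewrite mulrAC normrM (ger0_norm s0) -mulrA ler_pM//.
rewrite normrM normfV ler_pdivrMr ?normr_gt0 ?gt_eqF// -normrM.
exact: norm_sin_le.
Qed.

(** As functions of the parameter s, the sine integral [I] and the arctangent [G] have the same
    derivative, so [I - G] takes the same value at a and c. In difference form no integration
    constant has to be found. *)
Lemma integral_sin_sech_sub a c b : 0 < b ->
  \int[mu]_(x in D) (sin (a * x) / cosh (b * x) / x) -
  \int[mu]_(x in D) (sin (c * x) / cosh (b * x) / x) =
  2 * (atan (expR (a * pi / (2 * b))) - atan (expR (c * pi / (2 * b)))).
Proof.
move=> b0; have bN0 : b != 0 by rewrite gt_eqF.
pose f (s x : R) : R := sin (s * x) / cosh (b * x) / x.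
pose I (s : R) := \int[mu]_(x in D) f s x.
pose G (s : R) : R := 2 * atan (expR (s * pi / (2 * b))).
have GE (s : R) : is_derive s 1 G (pi / (2 * b) / cosh (s * pi / (2 * b))).
  rewrite /G; compute_derive.
  set u := s * pi / _; rewrite /cosh (expRN u).
  have := expR_gt0 u; move: (expR u) => e e0.
  have e2 : 0 < e ^+ 2 + 1 by rewrite addr_gt0// exprn_gt0.
  by field; rewrite bN0 !gt_eqF// ?addr_gt0 ?exprn_gt0// addrC.
have dE (s x : R) : 0 < x -> is_derive s 1 (fun y => f y x) (cos (s * x) / cosh (b * x)).
  move=> x0; rewrite /f; compute_derive.
  by field; rewrite !gt_eqF// cosh_gt0.
have IE (s : R) : is_derive s 1 I (pi / (2 * b) / cosh (s * pi / (2 * b))).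
  (* Any open window around s would do: the dominating function 1 / cosh (b y) is independent of the
     parameter. *)
  have Is : `](s - 1), (s + 1)[%classic s by rewrite /= in_itv/=; apply/andP; split; lra.
  have intf x : `](s - 1), (s + 1)[%classic x -> mu.-integrable D (EFin \o f x).
    by move=> _; exact: integrable_sin_sech.
  have derf x y : `](s - 1), (s + 1)[%classic x -> D y -> derivable (f ^~ y) x 1.
    by rewrite /= [y \in _]in_itv/= andbT => _ y0; have [] := dE x y y0.
  have G0 y : 0 <= (cosh (b * y))^-1 by have /andP[] := sech_le b y.
  have intG : mu.-integrable D (EFin \o (fun y => (cosh (b * y))^-1)).
    have := integrable_sech_tail 0 0 b b0; congr integrable; apply/funext => x /=.
    by rewrite /sech_tail mulr0 !mul0r oppr0 expR0 cos0 !mul1r.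
  have Gub x y : `](s - 1), (s + 1)[%classic x -> D y ->
      `|partial1of2 f x y| <= (cosh (b * y))^-1.
    rewrite /= [y \in _]in_itv/= andbT => _ y0.
    rewrite /partial1of2 (is_derive_derive1 _ _ _ (dE x y y0)).
    by rewrite normrM (ger0_norm (G0 y)) ler_piMl// cos_max.
  have dI := derivable_under_integral measurable_halfline Is intf derf G0 intG Gub.
  apply: DeriveDef; first exact: dI.
  rewrite -derive1E (differentiation_under_integral measurable_halfline Is intf derf G0 intG Gub).
  rewrite -integral_cos_sech//; apply: eq_Rintegral => x.
  rewrite inE/= in_itv/= andbT => x0.
  by rewrite /partial1of2 (is_derive_derive1 _ _ _ (dE s x x0)).
have := @is_derive_0_is_cst R (fun s => I s - G s) a c.
have H (s : R) : is_derive s 1 (fun s => I s - G s) 0.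
  have := IE s; have := GE s => ? ?.
  by compute_derive; ring.
move=> /(_ H); rewrite /G /I /f => E.
have swap (u v w z : R) : u - v = w - z -> u - w = v - z by clear; lra.
by rewrite mulrBr; exact: swap E.
Qed.

(** Positivity puts both arctangents in ]0, pi / 2[, so their difference stays in ]- pi / 2, pi /
    2[, where [atan] inverts [tan] and no multiple of pi appears. *)
Lemma atan_sub_gt0 x y : 0 < x -> 0 < y ->
  atan x - atan y = atan ((x - y) / (1 + x * y)).
Proof.
move=> x0 y0; have a0 (z : R) : 0 < z -> 0 < atan z.
  by move=> /lt_atan; rewrite atan0.
have ax := a0 _ x0; have ay := a0 _ y0.
have ax2 := @atan_ltpi2 R x; have ay2 := @atan_ltpi2 R y.
have cx : cos (atan x) != 0.
  by rewrite gt_eqF// cos_gt0_pihalf//; apply/andP; split; lra.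
have cy : cos (- atan y) != 0.
  by rewrite gt_eqF// cos_gt0_pihalf//; apply/andP; split; lra.
rewrite -[LHS]tanK; last by rewrite in_itv/=; apply/andP; split; lra.
by rewrite tanD// -atanN !atanK mulrN opprK.
Qed.

End half_line_integrals.

Theorem mainTheorem5 (R : realType) (a b beta : R) (beta_gt0 : 0 < beta) :
  (@lebesgue_measure R).-integrable `]0, +oo[
    (fun x : R => ((sin (a * x) - sin (b * x)) / cosh (beta * x) / x)%:E) /\
  (\int[@lebesgue_measure R]_(x in `]0%R, +oo[)
     ((sin (a * x) - sin (b * x)) / cosh (beta * x) / x)%:E =
   (2 * atan ((expR (a * pi / (2 * beta)) - expR (b * pi / (2 * beta)))
              / (1 + expR ((a + b) * pi / (2 * beta)))))%:E)%E.
Proof.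
have Ia := integrable_sin_sech a beta beta_gt0.
have Ib := integrable_sin_sech b beta beta_gt0.
have E : (fun x : R => ((sin (a * x) - sin (b * x)) / cosh (beta * x) / x)%:E) =
    (fun x => (sin (a * x) / cosh (beta * x) / x)%:E -
              (sin (b * x) / cosh (beta * x) / x)%:E)%E.
  by apply/funext => x; rewrite -EFinB !mulrBl.
have I : (@lebesgue_measure R).-integrable `]0, +oo[
    (fun x : R => ((sin (a * x) - sin (b * x)) / cosh (beta * x) / x)%:E).
  by rewrite E; apply: integrableB => //; exact: measurable_halfline.
(* Integrability makes the extended-real integral finite, so it may be computed as a real number. *)
split => //; rewrite -[LHS]fineK; last by apply: integrable_fin_num.
congr EFin; rewrite -[LHS]/(Rintegral _ _ _).
under eq_Rintegral do rewrite !mulrBl.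
rewrite RintegralB//.
rewrite integral_sin_sech_sub// atan_sub_gt0 ?expR_gt0// -expRD.
by rewrite -!mulrDl.
Qed.
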